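(* Every incomparability graph $G$ is ESP.
   Context: All graphs are finite and simple. An incomparability graph is a graph $G$ for which there is a partial order on $V(G)$ such that two distinct vertices are adjacent in $G$ if and only if they are incomparable in the partial order. ESP graphs. For a multiset $\Lambda$ of cliques of $G$ and $v\in V(G)$, $d_\Lambda(v)$ denotes the number of members of $\Lambda$ (with multiplicity) that contain $v$. A graph $G=(V,E)$ is equitably subpartitionable (ESP) if for every set $\Lambda$ of (inclusionwise) maximal cliques of $G$ there exist two multisets $\Lambda_1,\Lambda_2$ of cliques of $G$ (not necessarily members of $\Lambda$) such that (i) $|\Lambda_1|+|\Lambda_2|\le|\Lambda|$; (ii) $d_{\Lambda_1}(v)+d_{\Lambda_2}(v)\ge d_\Lambda(v)$ for all $v\in V$; (iii) $\min\{d_{\Lambda_1}(v),d_{\Lambda_2}(v)\}\ge\lfloor d_\Lambda(v)/2\rfloor$ for all $v\in V$. *)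

(* Defs.v *)
From mathcomp Require Import all_boot.

Set Implicit Arguments.
Unset Strict Implicit.
Unset Printing Implicit Defensive.

(* A finite simple graph is a finite type [V] of vertices with a symmetric and
   irreflexive adjacency relation [e : rel V]. *)

Section Graphs.

Variables (V : finType) (e : rel V).

Definition partial_order (le : rel V) : Prop :=
  [/\ reflexive le, antisymmetric le & transitive le].

Definition comparable_by (le : rel V) (x y : V) : bool := le x y || le y x.

Definition incomparability_graph : Prop :=
  exists2 le : rel V, partial_order le &
    forall x y : V, x != y -> e x y = ~~ comparable_by le x y.

Definition clique (K : {set V}) : bool :=
  [forall x in K, forall y in K, (x != y) ==> e x y].

Definition maximal_clique (K : {set V}) : bool := maxset clique K.

(* Multisets of vertex sets are encoded as sequences; only their size, the
   membership of their items and the degrees below are used, and these do not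
   depend on the order of the items. *)
Definition deg (L : seq {set V}) (v : V) : nat :=
  count (fun K : {set V} => v \in K) L.

(* [L] is a genuine set, without multiplicities, whereas [L1] and [L2] may
   repeat cliques. *)
Definition ESP : Prop :=
  forall L : {set {set V}}, {in L, forall K, maximal_clique K} ->
  exists L1 L2 : seq {set V},
    [/\ {in L1, forall K, clique K} /\ {in L2, forall K, clique K},
        size L1 + size L2 <= #|L|,
        forall v : V, deg (enum L) v <= deg L1 v + deg L2 v
      & forall v : V, (deg (enum L) v)./2 <= minn (deg L1 v) (deg L2 v)].

End Graphs.

(* Main.v *)
Require Import Defs.
From mathcomp Require Import all_boot.

(** The cliques of [G] are the antichains of a partial order [<=].  Given a
    family [s] of [k] antichains, let [rank v] be the number of members of [s]
    that contain some element strictly below [v], and give [v] the block of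
    [deg s v] consecutive colours starting at [rank v].

    An antichain through [v] has no element strictly below [v], so the members
    counted by [rank v] and by [deg s v] are different; hence all colours are
    smaller than [k].  If [x < y], a member of [s] that contains [x] or an
    element below [x] has an element below [y], so the block of [x] ends no
    later than the block of [y] begins ([rank_deg_lt]).  Hence the vertices
    having a given colour form an antichain, and these [k] colour classes cover
    [v] exactly [deg s v] times.

    Since the colours of [v] are consecutive, they alternate in parity: putting
    the classes of odd colour in one multiset and those of even colour in the
    other splits the degree of each vertex as evenly as possible. *)

Set Implicit Arguments.
Unset Strict Implicit.
Unset Printing Implicit Defensive.

Lemma count_odd_iota (a n : nat) :
  n./2 <= count odd (iota a n) /\ n./2 <= count (predC odd) (iota a n).
Proof.
(* Two consecutive integers contribute one to each count. *)
have [m] := ubnP n; elim: m => // m IHm in a n *.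
case: n => [|[|n]] //= /ltnW/IHm - /(_ a.+2) [IHo IHe].
by case: (odd a); rewrite /= ?add0n ?add1n ?ltnS.
Qed.

Lemma filter_iota_block (a n k : nat) :
  a + n <= k -> [seq c <- iota 0 k | a <= c < a + n] = iota a n.
Proof.
move=> le_k; rewrite -(subnKC le_k) !iotaD !filter_cat !add0n.
rewrite (eq_in_filter (a2 := pred0)) ?filter_pred0; last first.
  by move=> c; rewrite mem_iota => /andP[_ lt_c]; rewrite leqNgt lt_c.
rewrite cat0s [X in _ ++ X](eq_in_filter (a2 := pred0)) ?filter_pred0 ?cats0.
  by apply/all_filterP/allP => c; rewrite mem_iota.
by move=> c; rewrite mem_iota => /andP[le_c _];
  rewrite [c < _]ltnNge le_c andbF.
Qed.

Section Ranks.

Variables (V : finType) (e le : rel V).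
Hypothesis le_po : partial_order le.
Hypothesis eE : forall x y : V, x != y -> e x y = ~~ comparable_by le x y.

Let lt (x y : V) : bool := (x != y) && le x y.

Lemma lt_trans : transitive lt.
Proof.
case: le_po => _ le_anti le_trans y x z /andP[neq_xy le_xy] /andP[_ le_yz].
rewrite /lt (le_trans _ _ _ le_xy le_yz) andbT.
apply: contraNneq neq_xy => eq_xz; rewrite -eq_xz in le_yz.
by apply/eqP/le_anti; rewrite le_xy le_yz.
Qed.

Lemma cliqueP (K : {set V}) :
  reflect {in K &, forall x y, ~~ lt x y} (clique e K).
Proof.
apply: (iffP forall_inP) => cK x.
  move=> y xK yK; apply/andP => -[neq_xy le_xy].
  move/forall_inP: (cK x xK) => /(_ y yK)/implyP/(_ neq_xy).
  by rewrite eE // /comparable_by le_xy.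
move=> xK; apply/forall_inP => y yK; apply/implyP => neq_xy.
rewrite eE // negb_or; move: (cK x y xK yK) (cK y x yK xK).
by rewrite /lt [y == x]eq_sym neq_xy /= => -> ->.
Qed.

Definition above_some (v : V) (K : {set V}) : bool :=
  [exists x in K, lt x v].

Definition rank (s : seq {set V}) (v : V) : nat := count (above_some v) s.

Section CliqueFamily.

Variable s : seq {set V}.
Hypothesis s_clique : {in s, forall K, clique e K}.

(** A clique through [v] is an antichain, so [v] lies above none of its
    elements: no clique is counted both in the rank and in the degree. *)
Lemma rank_degE (v : V) :
  rank s v + deg s v = count (fun K => above_some v K || (v \in K)) s.
Proof.
rewrite /rank /deg -count_predUI [X in _ + X](_ : _ = 0) ?addn0 //.
apply/eqP; rewrite -leqn0 leqNgt -has_count.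
apply/hasPn => K /s_clique/cliqueP cK /=.
apply/andP => -[/exists_inP[x xK lt_xv] vK].
by move: (cK x v xK vK); rewrite lt_xv.
Qed.

Lemma rank_deg_le_size (v : V) : rank s v + deg s v <= size s.
Proof. by rewrite rank_degE count_size. Qed.

(** By transitivity, each clique that contains [x] or an element below [x] has
    an element below [y], so it is counted in the rank of [y]. *)
Lemma rank_deg_lt (x y : V) : lt x y -> rank s x + deg s x <= rank s y.
Proof.
move=> lt_xy; rewrite rank_degE; apply: sub_count => K.
case/orP => [/exists_inP[z zK lt_zx] | xK]; apply/exists_inP.
  by exists z => //; apply: lt_trans lt_xy.
by exists x.
Qed.

Definition colour_class (c : nat) : {set V} :=
  [set v | rank s v <= c < rank s v + deg s v].

(** Comparable vertices have disjoint blocks of colours. *)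
Lemma colour_class_clique (c : nat) : clique e (colour_class c).
Proof.
apply/cliqueP => x y; rewrite !inE => /andP[_ lt_c] /andP[ge_c _].
apply/negP => /rank_deg_lt le_xy.
by move: (leq_trans lt_c (leq_trans le_xy ge_c)); rewrite ltnn.
Qed.

Definition colour_classes (p : pred nat) : seq {set V} :=
  [seq colour_class c | c <- iota 0 (size s) & p c].

Lemma colour_classes_clique (p : pred nat) :
  {in colour_classes p, forall K, clique e K}.
Proof. by move=> _ /mapP[c _ ->]; apply: colour_class_clique. Qed.

Lemma deg_colour_classes (p : pred nat) (v : V) :
  deg (colour_classes p) v = count p (iota (rank s v) (deg s v)).
Proof.
rewrite -(filter_iota_block (rank_deg_le_size v)) /deg /colour_classes.
rewrite count_map !count_filter; apply: eq_count => c /=.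
by rewrite inE andbC.
Qed.

End CliqueFamily.

End Ranks.

Theorem theorem4p2 (V : finType) (e : rel V)
    (e_sym : symmetric e) (e_irr : irreflexive e)
    (e_incomp : incomparability_graph e) :
  ESP e.
Proof.
case: e_incomp => le le_po eE L L_max.
have cL : {in enum L, forall K, clique e K}.
  by move=> K; rewrite mem_enum => /L_max/maxsetp.
pose classes := colour_classes le (enum L).
have degE := deg_colour_classes eE cL.
exists (classes odd), (classes (predC odd)); split.
- have clE := colour_classes_clique le_po eE cL.
  by split=> K; apply: clE.
- by rewrite !size_map 2!size_filter count_predC size_iota cardE.
- by move=> v; rewrite !degE count_predC size_iota.
- by move=> v; rewrite !degE leq_min; apply/andP/count_odd_iota.
Qed.
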